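(* Let $f:\mathbb{R}^d\to\mathbb{R}$, $\delta>0$, and let $y_1,\dots,y_M\in\mathbb{R}^d$ satisfy $\|y_i-\bar y\|\le\delta$ for all $i$, where $\bar y=\frac1M\sum_{i=1}^M y_i$. (a) If $f$ is differentiable with $\|\nabla f(x)-\nabla f(y)\|\le L_g\|x-y\|$ for all $x,y\in\mathbb{R}^d$, then $$\|\nabla f(\bar y)\|\le\Big\|\frac1M\sum_{i=1}^M\nabla f_\delta(y_i)\Big\|+2L_g\delta.$$ (b) If $f$ is twice differentiable with $\|\nabla^2 f(x)-\nabla^2 f(y)\|\le L_H\|x-y\|$ for all $x,y\in\mathbb{R}^d$, then $$\|\nabla f(\bar y)\|\le\Big\|\frac1M\sum_{i=1}^M\nabla f_\delta(y_i)\Big\|+L_H\delta^2.$$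
   Context: $\|\cdot\|$ is the Euclidean norm on vectors and the operator norm on matrices. $\mathbb{B}^d$ is the closed unit ball of $\mathbb{R}^d$, and $f_\delta(x)=\mathbb{E}_{u\sim\mathrm{Unif}(\mathbb{B}^d)}[f(x+\delta u)]$ is the $\delta$-smoothed surrogate of $f$. *)

(* Defs.v *)
From HB Require Import structures.
From mathcomp Require Import all_boot all_order all_algebra.
From mathcomp Require Import all_classical all_reals all_analysis.
From mathcomp Require Import measurable_realfun lra.

Set Implicit Arguments.
Unset Strict Implicit.
Unset Printing Implicit Defensive.

Import Order.TTheory GRing.Theory Num.Theory.
Import numFieldNormedType.Exports.

Local Open Scope classical_set_scope.
Local Open Scope ring_scope.

(* R^d is 'rV[R]_d. The library norm on 'rV[R]_d is the max norm, hence enorm.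
   The two norms are equivalent, so [differentiable], which is stated with the
   library norm, is ordinary Frechet differentiability. *)
Definition enorm (R : realType) (n : nat) (x : 'rV[R]_n) : R :=
  Num.sqrt (\sum_(i < n) x 0 i ^+ 2).

(* Operator norm induced by enorm; a matrix acts on row vectors by v |-> v *m A,
   which is the convention of the library Jacobian 'J. *)
Definition opnorm (R : realType) (m n : nat) (A : 'M[R]_(m, n)) : R :=
  sup [set enorm (v *m A) | v in [set v : 'rV[R]_m | enorm v <= 1]].

Definition grad (R : realType) (d : nat) (f : 'rV[R]_d -> R) (x : 'rV[R]_d) :
  'rV[R]_d := \row_(i < d) 'D_(delta_mx 0 i) f x.

Definition hessian (R : realType) (d : nat) (f : 'rV[R]_d -> R)
  (x : 'rV[R]_d) : 'M[R]_d := 'J (grad f) x.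

Definition twice_differentiable (R : realType) (d : nat) (f : 'rV[R]_d -> R) :=
  (forall x, differentiable f x) /\ (forall x, differentiable (grad f) x).

Definition average (R : realType) (d M : nat) (y : 'I_M -> 'rV[R]_d) :
  'rV[R]_d := M%:R^-1 *: \sum_(i < M) y i.

(* The library puts the product sigma-algebra on n.-tuple T, but no measurable
   structure on 'rV[R]_n: measures on R^n live on tuples. *)
Section lebesgue_measure_tuple.
Context {R : realType}.
Local Notation T := (measurableTypeR R).

Definition cons_pair (n : nat) (p : T * n.-tuple T) : n.+1.-tuple T :=
  [tuple of p.1 :: p.2].

Lemma measurable_cons_pair (n : nat) : measurable_fun setT (@cons_pair n).
Proof. by apply: measurable_cons. Qed.

HB.instance Definition _ (n : nat) :=
  isMeasurableFun.Build _ _ _ _ (@cons_pair n) (@measurable_cons_pair n).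

Section step.
Variables (n : nat) (mu : {sigma_finite_measure set (n.-tuple T) -> \bar R}).

Definition lebesgue_cons : set (n.+1.-tuple T) -> \bar R :=
  pushforward (@lebesgue_measure R \x mu)%E (@cons_pair n).

Let lebesgue_cons0 : lebesgue_cons set0 = 0%E.
Proof. exact: measure0. Qed.

Let lebesgue_cons_ge0 A : (0 <= lebesgue_cons A)%E.
Proof. exact: measure_ge0. Qed.

Let lebesgue_cons_sigma_additive : semi_sigma_additive lebesgue_cons.
Proof. exact: measure_semi_sigma_additive. Qed.

HB.instance Definition _ := isMeasure.Build _ _ _ lebesgue_cons
  lebesgue_cons0 lebesgue_cons_ge0 lebesgue_cons_sigma_additive.

Lemma lebesgue_cons_sigma_finite : sigma_finite setT lebesgue_cons.
Proof.
pose un (t : n.+1.-tuple T) : T * n.-tuple T :=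
  (tnth t ord0, [tuple of behead t]).
have mun : measurable_fun setT un.
  apply/measurable_fun_pair; [exact: measurable_tnth|exact: measurable_behead].
have unK p : un (cons_pair p) = p.
  by case: p => a b; congr pair; apply/val_inj.
have /sigma_finiteP[F [TF ndF Foo]] := sigma_finiteT (@lebesgue_measure R).
have /sigma_finiteP[G [TG ndG Goo]] := sigma_finiteT mu.
exists (fun i => un @^-1` (F i `*` G i)) => [|i].
  rewrite -preimage_bigcup -(preimage_setT un) -setXTT TF TG; congr preimage.
  rewrite predeqE => -[x y]; split.
    move=> [/= [i _ Fix] [k _ Gky]]; exists (maxn i k) => //; split.
    - by move: x Fix; exact/subsetPset/ndF/leq_maxl.
    - by move: y Gky; exact/subsetPset/ndG/leq_maxr.
  by move=> [i _ []/= ? ?]; split; exists i.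
have [mF Fi] := Foo i; have [mG Gi] := Goo i; have mFG := measurableX mF mG.
split; first by rewrite -[_ @^-1` _]setTI; exact: mun.
rewrite /lebesgue_cons /pushforward -comp_preimage.
rewrite (_ : un \o _ = id); last by apply/funext => p; exact: unK.
by rewrite product_measure1E// lte_mul_pinfty// ge0_fin_numE.
Qed.

HB.instance Definition _ := Measure_isSigmaFinite.Build _ _ _ lebesgue_cons
  lebesgue_cons_sigma_finite.
End step.

Fixpoint lebesgue_tuple (n : nat) :
    {sigma_finite_measure set (n.-tuple T) -> \bar R} :=
  match n with
  | 0 => (\d_ [tuple])%E
  | n'.+1 => lebesgue_cons (lebesgue_tuple n')
  end.

End lebesgue_measure_tuple.

Definition rowt (R : realType) (n : nat)
  (t : n.-tuple (measurableTypeR R)) : 'rV[R]_n := \row_(i < n) tnth t i.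

Section uniform_unit_ball.
Context {R : realType} (d : nat).
Local Notation T := (measurableTypeR R).

Definition unit_ball : set (d.-tuple T) := [set t | enorm (rowt t) <= 1].

Lemma measurable_unit_ball : measurable unit_ball.
Proof.
have mN : measurable_fun setT (fun t : d.-tuple T => enorm (rowt t) : R).
  apply: (@measurableT_comp _ _ _ _ _ _ (@Num.sqrt R)).
    by apply: continuous_measurable_fun; exact: sqrt_continuous.
  apply: measurable_sum => i; apply: measurable_funX.
  rewrite (_ : (fun _ => _) = (fun t => tnth t i)).
    exact: measurable_tnth.
  by apply/funext => t; rewrite mxE.
rewrite (_ : unit_ball = setT `&` (fun t => enorm (rowt t)) @^-1` `]-oo, 1]).
  by apply: mN => //; exact: measurable_itv.
by rewrite setTI; apply/seteqP; split => t /=; rewrite in_itv.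
Qed.

(* Lebesgue measure restricted to the unit ball and normalized to mass 1; the
   Dirac mass is the dummy value of mnormalize for measures of mass 0 or +oo,
   which is not reached, see uniform_ballE. *)
Definition uniform_ball : probability (d.-tuple T) R :=
  mnormalize (mrestr (@lebesgue_tuple R d) measurable_unit_ball)
             (\d_ [tuple of nseq d (0%R : T)])%E.

End uniform_unit_ball.

Lemma lebesgue_tuple_box (R : realType) (a b : R) (n : nat) : a <= b ->
  measurable [set t : n.-tuple (measurableTypeR R) |
    forall i, tnth t i \in `[a, b]] /\
  lebesgue_tuple n [set t | forall i, tnth t i \in `[a, b]] =
    ((b - a) ^+ n)%:E.
Proof.
move=> ab.
have mbox k : measurable [set t : k.-tuple (measurableTypeR R) |
    forall i, tnth t i \in `[a, b]].
  rewrite (_ : [set _ | _] =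
      \big[setI/setT]_(i < k) ((@tnth k _)^~ i @^-1` `[a, b])).
    apply: bigsetI_measurable => i _; rewrite -[_ @^-1` _]setTI.
    by apply: measurable_tnth => //; exact: measurable_itv.
  rewrite -bigcap_seq; apply/seteqP; split=> t /= h i; first by move=> _; apply: h.
  by apply: h; rewrite /= mem_index_enum.
split=> //; elim: n => [|n IHn].
  by rewrite expr0 /= diracE mem_set// => -[].
rewrite /= /lebesgue_cons /pushforward.
rewrite (_ : _ @^-1` _ =
    `[a, b] `*` [set t | forall i, tnth t i \in `[a, b]]); last first.
  apply/seteqP; split=> [[x t] /= h|[x t] /= [xab h] i].
    split; first by have := h ord0; rewrite tnth0.
    by move=> i; have := h (lift ord0 i); rewrite tnthS.
  by case: (unliftP ord0 i) => [j ->|->]; rewrite ?tnthS ?tnth0.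
have mab : measurable (`[a, b]%classic : set (measurableTypeR R)).
  exact: measurable_itv.
have lab : lebesgue_measure (`[a, b]%classic : set (measurableTypeR R)) =
    (b - a)%:E.
  rewrite lebesgue_measure_itv/= lte_fin.
  by move: ab; rewrite le_eqVlt => /predU1P[<-|->]; rewrite ?ltxx ?subrr.
have := product_measure1E (@lebesgue_measure R) (lebesgue_tuple n) mab (mbox n).
by move=> ->; rewrite exprS EFinM -IHn; congr (_ * _)%E; exact: lab.
Qed.

Lemma lebesgue_unit_ball_gt0 (R : realType) (d : nat) :
  (0 < lebesgue_tuple d (@unit_ball R d))%E.
Proof.
have c0 : 0 <= d.+1%:R^-1 :> R by rewrite invr_ge0.
have [mB vB] := lebesgue_tuple_box d c0.
apply: (@lt_le_trans _ _ (d.+1%:R^-1 ^+ d : R)%:E).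
  by rewrite lte_fin exprn_gt0// invr_gt0.
rewrite -[X in X ^+ _]subr0 -vB; apply: le_measure; rewrite ?inE//.
  exact: measurable_unit_ball.
move=> t /= ht; rewrite /unit_ball /= /enorm -[leRHS]sqrtr1 ler_wsqrtr//.
apply: (@le_trans _ _ (\sum_(i < d) d.+1%:R^-1)).
  apply: ler_sum => i _; rewrite mxE.
  have := ht i; rewrite in_itv/= => /andP[t0 t1].
  have d1 : d.+1%:R^-1 <= 1 :> R by rewrite invf_le1// ler1n.
  by rewrite expr2 (le_trans (ler_pM t0 t0 t1 t1))// ler_piMr.
rewrite sumr_const card_ord -[leLHS]mulr_natl ler_pdivrMr// mul1r ler_nat.
exact: leqnSn.
Qed.

Lemma lebesgue_unit_ball_lty (R : realType) (d : nat) :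
  (lebesgue_tuple d (@unit_ball R d) < +oo)%E.
Proof.
have c0 : -1 <= 1 :> R by lra.
have [mB vB] := lebesgue_tuple_box d c0.
apply: le_lt_trans (ltry ((1 - -1) ^+ d : R)); rewrite -vB.
apply: le_measure; rewrite ?inE//; first exact: measurable_unit_ball.
move=> t /= ht i; rewrite in_itv/= -ler_norml -sqrtr_sqr.
apply: le_trans ht; rewrite /enorm ler_wsqrtr//.
rewrite (bigD1 i)//= mxE lerDl; apply: sumr_ge0 => j _; exact: sqr_ge0.
Qed.

Lemma uniform_ballE (R : realType) (d : nat)
    (A : set (d.-tuple (measurableTypeR R))) :
  uniform_ball d A = (lebesgue_tuple d (A `&` @unit_ball R d) *
    (fine (lebesgue_tuple d (@unit_ball R d)))^-1%:E)%E.
Proof.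
rewrite /uniform_ball /= /mnormalize /= /mrestr /= setTI.
by rewrite gt_eqF ?lebesgue_unit_ball_gt0// lt_eqF ?lebesgue_unit_ball_lty.
Qed.

Definition smooth (R : realType) (d : nat) (delta : R) (f : 'rV[R]_d -> R)
  (x : 'rV[R]_d) : R :=
  fine ('E_(uniform_ball d) [fun u => (f (x + delta *: rowt u))%R])%E.

(* Main.v *)
Require Import Defs.
From mathcomp Require Import all_boot all_order all_algebra.
From mathcomp Require Import all_classical all_reals all_analysis.
From mathcomp Require Import measurable_realfun lra ring.

Set Implicit Arguments.
Unset Strict Implicit.
Unset Printing Implicit Defensive.

Import Order.TTheory GRing.Theory Num.Theory.
Import numFieldNormedType.Exports.

Local Open Scope classical_set_scope.
Local Open Scope ring_scope.

(** Differentiating under the integral sign shows that the gradient of the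
    smoothed function at [x] is the mean of [grad f (x + delta *: u)] over the
    unit ball ([grad_smooth]). The difference between [grad f c], where [c] is
    the average of the points, and the average of the smoothed gradients is
    therefore the mean of [grad f c - grad f (y i + delta *: u)] over [i] and
    [u]. Its Euclidean norm is bounded by duality ([enorm_le_dual]): it is
    enough to bound its inner product with every vector [w] by [B * enorm w],
    and this only involves means of real functions.

    For (a), [y i + delta *: u] is at distance at most [2 * delta] from [c], so
    Cauchy-Schwarz and the Lipschitz bound suffice.

    For (b), expand [grad f] at [c] along [y i + delta *: u - c], with remainder
    at most [LH / 2] times the squared length ([grad_taylor]). With
    [s = y i - c], that square is at most
    [2 * delta ^+ 2 + 2 * delta * dot s u]. All the terms that are linear in [u]
    disappear because the uniform law on the ball is invariant under
    [u |-> - u] ([uniform_ball_opp], [ball_mean_odd]), and the term that is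
    linear in [s] disappears when summed over [i] because [c] is the average.
    What remains is [LH * delta ^+ 2].

    Both parts are thus instances of one statement, [gap_le], in which an upper
    bound may contain a term linear in [y i - c] and a term linear in [u]. *)

(** * Euclidean geometry of row vectors *)

Section euclidean.
Context {R : realType} {n : nat}.
Implicit Types u v w : 'rV[R]_n.

Definition dot u v : R := \sum_(i < n) u 0 i * v 0 i.

Lemma dotC u v : dot u v = dot v u.
Proof. by apply: eq_bigr => i _; rewrite mulrC. Qed.

Lemma dotDr w u v : dot w (u + v) = dot w u + dot w v.
Proof.
by rewrite /dot -big_split; apply: eq_bigr => i _; rewrite mxE mulrDr.
Qed.

Lemma dotZr w a u : dot w (a *: u) = a * dot w u.
Proof.
by rewrite /dot mulr_sumr; apply: eq_bigr => i _; rewrite mxE mulrCA.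
Qed.

Lemma dotNr w u : dot w (- u) = - dot w u.
Proof. by rewrite -scaleN1r dotZr mulN1r. Qed.

Lemma dotBr w u v : dot w (u - v) = dot w u - dot w v.
Proof. by rewrite dotDr dotNr. Qed.

Lemma dotDl u v w : dot (u + v) w = dot u w + dot v w.
Proof. by rewrite dotC dotDr !(dotC w). Qed.

Lemma dotZl a u v : dot (a *: u) v = a * dot u v.
Proof. by rewrite dotC dotZr dotC. Qed.

Lemma dotNl u v : dot (- u) v = - dot u v.
Proof. by rewrite dotC dotNr dotC. Qed.

Lemma dot0r w : dot w 0 = 0.
Proof. by rewrite -(scale0r 0) dotZr mul0r. Qed.

Lemma dot_sumr w (I : Type) (r : seq I) (F : I -> 'rV[R]_n) :
  dot w (\sum_(i <- r) F i) = \sum_(i <- r) dot w (F i).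
Proof. by apply: (big_morph _ (dotDr w) (dot0r w)). Qed.

Lemma enorm_ge0 v : 0 <= enorm v.
Proof. exact: sqrtr_ge0. Qed.

Lemma sqr_enorm v : enorm v ^+ 2 = dot v v.
Proof.
rewrite sqr_sqrtr; last by apply: sumr_ge0 => i _; exact: sqr_ge0.
by apply: eq_bigr => i _; rewrite expr2.
Qed.

Lemma enormZ a v : enorm (a *: v) = `|a| * enorm v.
Proof.
rewrite -sqrtr_sqr /enorm -sqrtrM ?sqr_ge0// mulr_sumr; congr Num.sqrt.
by apply: eq_bigr => i _; rewrite mxE exprMn.
Qed.

Lemma enormN v : enorm (- v) = enorm v.
Proof. by rewrite -scaleN1r enormZ normrN1 mul1r. Qed.

Lemma normr_coord_le_enorm v i : `|v 0 i| <= enorm v.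
Proof.
rewrite -sqrtr_sqr ler_wsqrtr// (bigD1 i)//= lerDl.
by apply: sumr_ge0 => j _; exact: sqr_ge0.
Qed.

Lemma enorm0_eq0 v : enorm v = 0 -> v = 0.
Proof.
move=> v0; apply/rowP => i; apply/eqP; rewrite !mxE -normr_le0 -v0.
exact: normr_coord_le_enorm.
Qed.

(** Cauchy-Schwarz: expand the squared norm of
    [enorm v *: u - enorm u *: v]. *)
Lemma dot_le_enorm u v : dot u v <= enorm u * enorm v.
Proof.
have [/enorm0_eq0 ->|u0] := eqVneq (enorm u) 0.
  by rewrite dotC dot0r mulr_ge0// enorm_ge0.
have [/enorm0_eq0 ->|v0] := eqVneq (enorm v) 0.
  by rewrite dot0r mulr_ge0// enorm_ge0.
have up : 0 < enorm u by rewrite lt_neqAle eq_sym u0 enorm_ge0.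
have vp : 0 < enorm v by rewrite lt_neqAle eq_sym v0 enorm_ge0.
have := sqr_ge0 (enorm (enorm v *: u - enorm u *: v)).
rewrite sqr_enorm dotBr !dotZr !(dotC (_ - _)) !dotBr !dotZr (dotC v u).
rewrite -!sqr_enorm => h.
have : 0 <= 2 * (enorm u * enorm v) * (enorm u * enorm v - dot u v) by nra.
by rewrite pmulr_rge0 ?subr_ge0// mulr_gt0// mulr_gt0.
Qed.

Lemma sqr_enormD u v :
  enorm (u + v) ^+ 2 = enorm u ^+ 2 + 2 * dot u v + enorm v ^+ 2.
Proof. by rewrite !sqr_enorm dotDl !dotDr (dotC v u); ring. Qed.

Lemma enormD u v : enorm (u + v) <= enorm u + enorm v.
Proof.
rewrite -(@ler_pXn2r _ 2)// ?nnegrE ?addr_ge0 ?enorm_ge0//.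
rewrite sqr_enormD; have := dot_le_enorm u v; nra.
Qed.

(** Taking [w := v] is enough. This is what turns a bound on the norm of a
    vector-valued mean into bounds on real-valued means. *)
Lemma enorm_le_dual v B : 0 <= B ->
  (forall w, dot w v <= enorm w * B) -> enorm v <= B.
Proof.
move=> B0 h; have [->//|v0] := eqVneq (enorm v) 0.
have vp : 0 < enorm v by rewrite lt_neqAle eq_sym v0 enorm_ge0.
by rewrite -(ler_pM2l vp) -expr2 sqr_enorm.
Qed.

Lemma continuous_cstM (T : topologicalType) (a : R) (g : T -> R) :
  continuous g -> continuous (fun x => a * g x).
Proof.
by move=> cg x; apply: (@continuousM _ _ (cst a) g);
  [exact: cst_continuous|exact: cg].
Qed.

Lemma enorm_continuous : continuous (@enorm R n).
Proof.
move=> v.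
apply: (@continuous_comp _ _ _ (fun v : 'rV[R]_n => \sum_(i < n) v 0 i ^+ 2));
  last exact: sqrt_continuous.
move: v; apply: continuous_big => [|i _ v]; first exact: add_continuous.
apply: (@continuous_comp _ _ _ (fun v : 'rV[R]_n => v 0 i) (fun x => x ^+ 2)).
  exact: coord_continuous.
exact: exprn_continuous.
Qed.

Lemma dot_continuous w : continuous (dot w).
Proof.
apply: continuous_big => [|i _]; first exact: add_continuous.
apply: (@continuous_cstM 'rV[R]_n) => v; exact: coord_continuous.
Qed.

End euclidean.

(** The supremum that defines [opnorm] exists: on the unit ball every coordinate
    is at most 1 in absolute value, so the image is bounded entry by entry. *)
Lemma enorm_mulmx_le (R : realType) (m n : nat) (A : 'M[R]_(m, n)) v :
  enorm (v *m A) <= opnorm A * enorm v.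
Proof.
set S := [set enorm (w *m A) | w in [set w : 'rV[R]_m | enorm w <= 1]].
have hS : has_sup S.
  split; first by exists (enorm ((0 : 'rV_m) *m A)); exists 0 => //=;
    rewrite /enorm big1 ?sqrtr0// => i _; rewrite mxE expr0n.
  exists (Num.sqrt (\sum_(j < n) (\sum_(i < m) `|A i j|) ^+ 2)).
  move=> _ [w /= w1 <-].
  rewrite ler_wsqrtr//; apply: ler_sum => j _.
  rewrite -real_normK ?num_real// lerXn2r ?nnegrE ?sumr_ge0//.
  rewrite mxE; apply: le_trans (ler_norm_sum _ _ _) _; apply: ler_sum => i _.
  rewrite normrM ler_piMl//; exact: le_trans (normr_coord_le_enorm _ _) w1.
have [/enorm0_eq0 ->|v0] := eqVneq (enorm v) 0.
  by rewrite mul0mx /enorm !big1 ?sqrtr0 ?mulr0// => i _; rewrite mxE expr0n.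
have vp : 0 < enorm v by rewrite lt_neqAle eq_sym v0 enorm_ge0.
rewrite -ler_pdivrMr// mulrC -[X in X * _]gtr0_norm ?invr_gt0//.
rewrite -enormZ scalemxAl.
apply: sup_upper_bound => //; exists ((enorm v)^-1 *: v) => //=.
by rewrite enormZ gtr0_norm ?invr_gt0// mulVf.
Qed.

Lemma enorm_delta (R : realType) (n : nat) (i : 'I_n) :
  enorm (delta_mx 0 i : 'rV[R]_n) = 1.
Proof.
rewrite /enorm (bigD1 i)//= big1 => [|j ji].
  by rewrite mxE !eqxx expr1n addr0 sqrtr1.
by rewrite mxE (negbTE ji) andbF expr0n.
Qed.

Lemma dot_mulmx (R : realType) (m n : nat) (w : 'rV[R]_n) (v : 'rV[R]_m)
  (A : 'M[R]_(m, n)) : dot w (v *m A) = dot (w *m A^T) v.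
Proof.
rewrite /dot; under eq_bigr do rewrite mxE mulr_sumr.
rewrite exchange_big; apply: eq_bigr => i _; rewrite mxE mulr_suml.
by apply: eq_bigr => j _; rewrite mxE mulrCA mulrC.
Qed.

(** * Measurability of continuous functions of a tuple *)

Section measurable_row.
Context {R : realType} {n : nat}.
Local Notation T := (measurableTypeR R).

Lemma measurable_preimage_ball (c : 'rV[R]_n) (r : R) :
  measurable ((@rowt R n) @^-1` ball c r).
Proof.
have [r0|r0] := ltP 0 r; last first.
  by rewrite (_ : _ @^-1` _ = set0)// -subset0 => t [/lt_geF]; rewrite r0.
rewrite (_ : _ @^-1` _ =
    \big[setI/setT]_(i < n) ((@tnth n T)^~ i @^-1` ball (c 0 i) r)).
  apply: bigsetI_measurable => i _; rewrite -[_ @^-1` _]setTI.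
  apply: measurable_tnth => //; rewrite ball_itv; exact: measurable_itv.
rewrite -bigcap_seq; apply/seteqP; split=> t /= h.
  by move=> i _; case: h => _ /(_ 0 i); rewrite mxE.
split=> // i j; rewrite (ord1 i) mxE.
by have := h j; apply; rewrite /= mem_index_enum.
Qed.

(** The tuples carry the product sigma-algebra while openness refers to the
    topology of row vectors. The two meet because an open set is the union of
    the countably many balls with rational centre and radius [k.+1%:R^-1] that
    it contains, and the balls of the max norm are boxes. *)
Lemma measurable_preimage_open (U : set 'rV[R]_n) :
  open U -> measurable (@rowt R n @^-1` U).
Proof.
move=> oU.
pose V (p : 'rV[rat]_n * nat) : set 'rV[R]_n :=
  ball (map_mx ratr p.1 : 'rV[R]_n) p.2.+1%:R^-1.
rewrite (_ : _ @^-1` U = \bigcup_p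
    (if `[< V p `<=` U >] then @rowt R n @^-1` V p else set0)).
  apply: countable_bigcupT_measurable => // p.
  case: ifPn => _ //; exact: measurable_preimage_ball.
apply/seteqP; split=> [t Ut|t [p _]]; last first.
  by case: ifPn => //= /asboolP VU /VU.
have /nbhs_ballP[e /= e0 eU] : nbhs (rowt t) U by apply: open_nbhs_nbhs.
(* A radius below e / 2, so that a ball that contains the point and has this
   radius lies in the ball of radius e around the point. *)
have [k ke] : exists k, k.+1%:R^-1 < e / 2.
  have e20 : 0 < e / 2 by rewrite divr_gt0.
  exists (Num.trunc (e / 2)^-1).
  by rewrite invf_plt ?posrE// truncnS_gt.
have k0 : 0 < k.+1%:R^-1 :> R by rewrite invr_gt0.
have /choice[c hc] : forall i, exists q, ratr q \in
    `](tnth t i - k.+1%:R^-1), (tnth t i + k.+1%:R^-1)[.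
  by move=> i; apply: rat_in_itvoo; rewrite ltrD2l gtrN.
have tV : ball (map_mx ratr (\row_i c i) : 'rV[R]_n) k.+1%:R^-1 (rowt t).
  split=> // i j; rewrite (ord1 i) !mxE.
  have := hc j; rewrite ball_itv/= !in_itv/= => /andP[h1 h2].
  by rewrite ltrBlDr h2 -ltrBlDr h1.
exists (\row_i c i, k) => //=; rewrite ifT//; apply/asboolP => z Vz.
apply: eU; apply: (@le_ball _ _ _ (k.+1%:R^-1 + k.+1%:R^-1)).
  by rewrite (splitr e) lerD// ltW.
by apply: ball_triangle Vz; apply: ball_sym.
Qed.

Lemma measurable_fun_rowt (F : 'rV[R]_n -> R) :
  continuous F -> measurable_fun setT (fun t : n.-tuple T => F (rowt t)).
Proof.
move=> /continuousP cF; apply: (measurability _ (RGenOpens.measurableE R)).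
move=> _ [_ [a [b ->] <-]]; rewrite setTI.
have mU := @measurable_preimage_open (F @^-1` `]a, b[); apply: mU; apply: cF.
exact: interval_open.
Qed.

End measurable_row.

(** * Reflection invariance of the uniform law on the ball *)

Section reflection.
Context {R : realType}.
Local Notation T := (measurableTypeR R).

Definition opp_tuple (n : nat) (t : n.-tuple T) : n.-tuple T := map_tuple -%R t.

Lemma tnth_opp_tuple n (t : n.-tuple T) i : tnth (opp_tuple t) i = - tnth t i.
Proof. by rewrite tnth_map. Qed.

Lemma rowt_opp_tuple n (t : n.-tuple T) : rowt (opp_tuple t) = - rowt t.
Proof. by apply/rowP => i; rewrite !mxE tnth_opp_tuple. Qed.

Lemma measurable_opp_tuple n : measurable_fun setT (@opp_tuple n).
Proof.
apply/measurable_fun_tnthP => i.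
rewrite (_ : _ \o _ = (fun t => - tnth t i)).
  apply: (@measurableT_comp _ _ _ _ _ _ (-%R : R -> R)) => //.
  exact: measurable_tnth.
by apply/funext => t /=; rewrite tnth_opp_tuple.
Qed.

Lemma lebesgue_measure_opp (A : set T) : measurable A ->
  lebesgue_measure (-%R @^-1` A) = lebesgue_measure A.
Proof.
move=> mA.
have mopp : measurable_fun [set: T] (-%R : T -> T) by exact: oppr_measurable.
pose mu : {measure set T -> \bar R} :=
  pushforward (@lebesgue_measure R) (-%R : T -> T).
rewrite -[LHS]/(mu mopp A) -(@lebesgue_measure_unique R (mu mopp))//.
move=> X [[a b] /= _ <-].
rewrite /mu /= /pushforward (_ : _ @^-1` _ = `[(- b), (- a)[%classic).
  rewrite !lebesgue_measure_itv /= !lte_fin ltrN2 -!EFinB opprK.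
  by rewrite addrC.
by apply/seteqP; split=> x /=; rewrite !in_itv/= lerNl ltrNr => /andP[-> ->].
Qed.

(** In each dimension the image measure agrees with the product measure on
    rectangles, by the one-dimensional case and the induction hypothesis. *)
Lemma lebesgue_tuple_opp (n : nat) (A : set (n.-tuple T)) : measurable A ->
  lebesgue_tuple n (@opp_tuple n @^-1` A) = lebesgue_tuple n A.
Proof.
elim: n A => [|n IHn] A mA.
  rewrite (_ : @opp_tuple 0 = id) ?preimage_id//.
  by apply/funext => t; apply: val_inj; rewrite (tuple0 t).
pose oo (p : T * n.-tuple T) : T * n.-tuple T := (- p.1, opp_tuple p.2).
have moo : measurable_fun setT oo.
  apply/measurable_fun_pair.
    by apply: (@measurableT_comp _ _ _ _ _ _ (-%R : R -> R)).
  by apply: (@measurableT_comp _ _ _ _ _ _ (@opp_tuple n));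
    [exact: measurable_opp_tuple|exact: measurable_snd].
pose mu : {measure set (T * n.-tuple T) -> \bar R} :=
  pushforward (@lebesgue_measure R \x lebesgue_tuple n)%E oo.
rewrite /= /lebesgue_cons /pushforward.
have -> : @cons_pair R n @^-1` (@opp_tuple n.+1 @^-1` A) =
    oo @^-1` (@cons_pair R n @^-1` A).
  apply/seteqP; split=> -[x t] /=;
    rewrite (_ : opp_tuple _ = cons_pair (oo (x, t)))//; exact/val_inj.
have mA' : measurable (@cons_pair R n @^-1` A).
  by rewrite -[_ @^-1` _]setTI; exact: measurable_cons_pair.
rewrite -[LHS]/(mu moo _).
have muE := @product_measure_unique _ _ _ _ _ (@lebesgue_measure R)
  (lebesgue_tuple n) (mu moo).
symmetry; apply: muE => // B C mB mC.
rewrite /mu /= /pushforward.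
have -> : oo @^-1` (B `*` C) = (-%R @^-1` B) `*` (@opp_tuple n @^-1` C) by [].
have mB' : measurable (-%R @^-1` B : set T).
  by rewrite -[_ @^-1` _]setTI; exact: oppr_measurable.
have mC' : measurable (@opp_tuple n @^-1` C).
  by rewrite -[_ @^-1` _]setTI; exact: measurable_opp_tuple.
have /= -> :=
  product_measure1E (@lebesgue_measure R) (lebesgue_tuple n) mB' mC'.
by rewrite -(IHn C)// -(lebesgue_measure_opp mB).
Qed.

End reflection.

Lemma uniform_ball_opp (R : realType) (n : nat)
    (A : set (n.-tuple (measurableTypeR R))) : measurable A ->
  uniform_ball n (@opp_tuple R n @^-1` A) = uniform_ball n A.
Proof.
move=> mA; rewrite !uniform_ballE; congr (_ * _)%E.
rewrite -[RHS]lebesgue_tuple_opp; last first.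
  by apply: measurableI => //; exact: measurable_unit_ball.
congr (lebesgue_tuple n _); rewrite preimage_setI; congr setI.
by apply/seteqP; split=> t; rewrite /unit_ball /= rowt_opp_tuple enormN.
Qed.

(** * Means over the unit ball *)

Section ball_mean.
Context {R : realType} {d : nat}.
Local Notation T := (measurableTypeR R).
Implicit Types F G : 'rV[R]_d -> R.

(** The domain of integration is the ball and not the whole space: the law
    does not charge the complement ([smoothE]), and continuous functions are
    bounded on the ball, hence integrable there. *)
Definition ball_mean F : R :=
  \int[uniform_ball d]_(t in @unit_ball R d) F (rowt t).

Lemma uniform_ball_unit_ball : uniform_ball d (@unit_ball R d) = 1%E.
Proof.
rewrite uniform_ballE setIid.
have := lebesgue_unit_ball_gt0 R d; have := lebesgue_unit_ball_lty R d.
case: (lebesgue_tuple d (@unit_ball R d)) => [r| |]//= _.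
by rewrite lte_fin => r0; rewrite -EFinM mulfV// gt_eqF.
Qed.

Lemma enorm_le1_normr (v : 'rV[R]_d) : enorm v <= 1 -> `|v| <= 1.
Proof.
move=> v1; rewrite [leLHS]/Num.norm/= mx_normrE.
apply: bigmax_le => // -[i j] _.
by rewrite (ord1 i); apply: le_trans (normr_coord_le_enorm _ _) v1.
Qed.

Lemma continuous_bounded_ball F (r : R) : continuous F ->
  exists C, forall v, `|v| <= r -> `|F v| <= C.
Proof.
move=> cF; have cB : compact [set v : 'rV[R]_d | `|v| <= r].
  apply: bounded_closed_compact.
    exists r; split; rewrite ?num_real// => M rM v /= /le_trans; apply.
    exact: ltW.
  rewrite (_ : mkset _ = (fun v : 'rV[R]_d => `|v|) @^-1` [set x | x <= r])//.
  apply: preimage_closed; last exact: closed_le.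
  by move=> v _; exact: norm_continuous.
have cFw : {within [set v : 'rV[R]_d | `|v| <= r], continuous F}.
  exact: continuous_subspaceT.
have [M [_ hM]] := compact_bounded (continuous_compact cFw cB).
exists (M + 1) => v vr; apply: hM; first by rewrite ltrDl.
by exists v.
Qed.

Lemma integrable_rowt F : continuous F ->
  (uniform_ball d).-integrable (@unit_ball R d) (EFin \o (fun t => F (rowt t))).
Proof.
move=> cF; apply: measurable_bounded_integrable.
- exact: measurable_unit_ball.
- by rewrite [ltLHS]uniform_ball_unit_ball ltry.
- exact: measurable_funTS (measurable_fun_rowt cF).
have [C hC] := continuous_bounded_ball 1 cF.
exists C; split; rewrite ?num_real// => M CM t tB.
by apply: le_trans (ltW CM); apply/hC/enorm_le1_normr.
Qed.

Lemma ball_meanB F G : continuous F -> continuous G ->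
  ball_mean (fun v => F v - G v) = ball_mean F - ball_mean G.
Proof.
move=> cF cG; rewrite /ball_mean RintegralB//; try exact: integrable_rowt.
exact: measurable_unit_ball.
Qed.

Lemma ball_meanD F G : continuous F -> continuous G ->
  ball_mean (fun v => F v + G v) = ball_mean F + ball_mean G.
Proof.
move=> cF cG; rewrite /ball_mean RintegralD//; try exact: integrable_rowt.
exact: measurable_unit_ball.
Qed.

Lemma ball_meanZ a F : continuous F ->
  ball_mean (fun v => a * F v) = a * ball_mean F.
Proof.
move=> cF; rewrite /ball_mean RintegralZl//; last exact: integrable_rowt.
exact: measurable_unit_ball.
Qed.

Lemma ball_mean_cst a : ball_mean (fun=> a) = a.
Proof.
rewrite /ball_mean Rintegral_cst; last exact: measurable_unit_ball.
by rewrite [X in fine X]uniform_ball_unit_ball mulr1.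
Qed.

Lemma ball_mean_sum (I : Type) (r : seq I) (F : I -> 'rV[R]_d -> R) :
  (forall i, continuous (F i)) ->
  ball_mean (fun v => \sum_(i <- r) F i v) = \sum_(i <- r) ball_mean (F i).
Proof.
move=> cF; elim: r => [|i r IHr].
  under [in LHS]eq_fun do rewrite big_nil.
  by rewrite ball_mean_cst big_nil.
under [in LHS]eq_fun do rewrite big_cons.
rewrite ball_meanD// ?IHr ?big_cons//.
by apply: continuous_big => // ; exact: add_continuous.
Qed.

Lemma le_ball_mean F G : continuous F -> continuous G ->
  (forall v, enorm v <= 1 -> F v <= G v) -> ball_mean F <= ball_mean G.
Proof.
move=> cF cG FG; apply: le_Rintegral; try exact: integrable_rowt.
  exact: measurable_unit_ball.
by move=> t; exact: FG.
Qed.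

Lemma ball_mean_opp F : continuous F ->
  ball_mean (fun v => F (- v)) = ball_mean F.
Proof.
move=> cF.
have mopp := @measurable_opp_tuple R d.
have mB := @measurable_unit_ball R d.
have preB : @opp_tuple R d @^-1` @unit_ball R d = @unit_ball R d.
  by apply/seteqP; split=> t; rewrite /unit_ball /= rowt_opp_tuple enormN.
rewrite /ball_mean /Rintegral; congr fine.
transitivity (\int[pushforward (uniform_ball d) (@opp_tuple R d)]_(t in
    @unit_ball R d) (F (rowt t))%:E)%E.
  rewrite integral_pushforward//.
  - by rewrite preB; apply: eq_integral => t _ /=; rewrite rowt_opp_tuple.
  - by apply/measurable_EFinP; exact: measurable_fun_rowt.
  - rewrite preB.
    rewrite (_ : _ \o _ = EFin \o (fun t => (fun v => F (- v)) (rowt t))).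
      apply: (integrable_rowt (F := fun v => F (- v))) => v.
      by apply: continuous_comp; [exact: opp_continuous|exact: cF].
    by apply/funext => t /=; rewrite rowt_opp_tuple.
apply: eq_measure_integral => A mA _; exact: uniform_ball_opp.
Qed.

Lemma ball_mean_odd F : continuous F -> (forall v, F (- v) = - F v) ->
  ball_mean F = 0.
Proof.
move=> cF oF; have := ball_mean_opp cF.
rewrite (_ : (fun v => F (- v)) = (fun v => -1 * F v)).
  rewrite ball_meanZ//; lra.
by apply/funext => v; rewrite oF mulN1r.
Qed.

Lemma continuous_affine F (x : 'rV[R]_d) (r : R) : continuous F ->
  continuous (fun v : 'rV[R]_d => F (x + r *: v)).
Proof.
move=> cF v.
apply: (@continuous_comp _ _ _ (fun v : 'rV[R]_d => x + r *: v));
  last exact: cF.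
apply: (@continuousD _ _ _ (cst x) (fun v : 'rV[R]_d => r *: v)).
  exact: cst_continuous.
exact: scaler_continuous.
Qed.

Lemma smoothE (delta : R) F (x : 'rV[R]_d) : continuous F ->
  smooth delta F x = ball_mean (fun v => F (x + delta *: v)).
Proof.
move=> cF; have cG := continuous_affine (x := x) (r := delta) cF.
have mB := @measurable_unit_ball R d.
rewrite /smooth unlock /ball_mean /Rintegral; congr fine.
rewrite [RHS]integral_mkcond; apply: ae_eq_integral => //.
- by apply/measurable_EFinP; exact: measurable_fun_rowt cG.
- apply/(measurable_restrictT _ mB)/measurable_EFinP.
  exact: measurable_funTS (measurable_fun_rowt cG).
exists (~` @unit_ball R d); split; first exact: measurableC.
  rewrite [LHS](probability_setC (uniform_ball d) mB).
  by rewrite [X in (1 - X)%E]uniform_ball_unit_ball subee.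
move=> t; apply: contra_not => tB _.
by rewrite patchE mem_set.
Qed.

End ball_mean.

(** A linear term in an upper bound is free, since its mean is zero. *)
Lemma ball_mean_le (R : realType) (d : nat) (F : 'rV[R]_d -> R) (C : R)
    (a : 'rV[R]_d) : continuous F ->
  (forall v, enorm v <= 1 -> F v <= C + dot a v) -> ball_mean F <= C.
Proof.
move=> cF FC; have ca := dot_continuous (w := a).
have -> : C = ball_mean (fun v => C + dot a v).
  rewrite ball_meanD//; last exact: cst_continuous.
  rewrite ball_mean_cst ball_mean_odd ?addr0// => v; exact: dotNr.
apply: le_ball_mean => // v.
by apply: (@continuousD _ _ _ (cst C) (dot a));
  [exact: cst_continuous|exact: ca].
Qed.

(** * Derivatives along lines *)

Section line.
Context {R : realType} {V W : normedModType R}.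
Implicit Types (f : V -> W) (a v : V).

Lemma line_quotientE f a v (t : R) :
  (fun h => h^-1 *: (f (a + (h + t) *: v) - f (a + t *: v))) =
  (fun h => h^-1 *: ((f \o shift (a + t *: v)) (h *: v) - f (a + t *: v))).
Proof. by apply/funext => h /=; rewrite scalerDl addrCA. Qed.

(** The two difference quotients coincide, so this holds even where the
    derivative does not exist. *)
Lemma derive1_line f a v (t : R) :
  derive1 (fun s : R => f (a + s *: v)) t = 'D_v f (a + t *: v).
Proof. by rewrite /derive1 line_quotientE. Qed.

Lemma derivable_line f a v (t : R) :
  derivable f (a + t *: v) v -> derivable (fun s : R => f (a + s *: v)) t 1.
Proof.
rewrite /derivable -line_quotientE /=.
by under [in X in _ -> X]eq_fun do rewrite [_ *: 1]mulr1.
Qed.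

End line.

(** The function [t |-> p t - dp 0 * t - K / 2 * t ^+ 2] is nonincreasing on
    the unit interval. The mean value theorem applied to [p] alone would only
    give [K]. *)
Lemma taylor1_le (R : realType) (p dp : R -> R) (K : R) :
  (forall t : R, is_derive t 1 p (dp t)) ->
  (forall t, 0 <= t -> dp t - dp 0 <= K * t) ->
  p 1 - p 0 - dp 0 <= K / 2.
Proof.
move=> pdp dpK.
pose q t := p t - dp 0 * t - K / 2 * t ^+ 2.
have qd (t : R) : is_derive t 1 q (dp t - dp 0 - K * t).
  have -> : q = p - dp 0 \*: id - (K / 2) \*: (id ^+ 2).
    by apply/funext => s; rewrite /q !fctE.
  apply: is_derive_eq; rewrite /= expr1 /GRing.scale /= !mulr1; lra.
have : q 1 <= q 0.
  apply: (@ler0_derive1_nincr _ q 0 1) => //.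
  - by move=> t; rewrite in_itv/= derive1E derive_val => /andP[/ltW/dpK]; lra.
  - apply: continuous_subspaceT => t.
    exact/differentiable_continuous/derivable1_diffP.
rewrite /q; lra.
Qed.

Lemma is_derive_dot (R : realType) (V : normedModType R) (n : nat)
    (w : 'rV[R]_n) (g : V -> 'rV[R]_n) (a v : V) :
  derivable g a v ->
  is_derive a v (fun z => dot w (g z)) (dot w ('D_v g a)).
Proof.
move=> dg; rewrite derive_mx//.
have -> : (fun z => dot w (g z)) =
    \sum_(i < n) ((w 0 i) \*: (fun z => g z 0 i : R)).
  by apply/funext => z; rewrite fct_sumE.
have -> : dot w (\matrix_(i < 1, j < n) 'D_v (fun z => g z i j) a) =
    \sum_(i < n) (w 0 i) *: 'D_v (fun z => g z 0 i) a.
  by apply: eq_bigr => i _; rewrite mxE.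
apply: is_derive_sum => i; apply: is_deriveZ.
by apply: derivableP; move/derivable_mxP : dg; exact.
Qed.

(** The one-dimensional estimate for [s |-> dot w (grad f (c + s *: v))];
    pairing with [w] first loses nothing, since the norm is recovered by duality. *)
Lemma grad_taylor (R : realType) (d : nat) (f : 'rV[R]_d -> R) (LH : R)
    (c v w : 'rV[R]_d) :
  (forall x, differentiable (grad f) x) ->
  (forall x z, opnorm (hessian f x - hessian f z) <= LH * enorm (x - z)) ->
  dot w (grad f (c + v) - grad f c - v *m hessian f c) <=
    LH * enorm w * enorm v ^+ 2 / 2.
Proof.
move=> dg HL.
pose p s := dot w (grad f (c + s *: v)).
pose dp s := dot w (v *m hessian f (c + s *: v)).
have pdp (t : R) : is_derive t 1 p (dp t).
  rewrite /dp /hessian -deriveEjacobian//.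
  rewrite -(derive1_line (grad f)) derive1E.
  apply: is_derive_dot; apply: derivable_line; exact: diff_derivable.
have dpL t : 0 <= t -> dp t - dp 0 <= LH * enorm w * enorm v ^+ 2 * t.
  move=> t0; rewrite /dp -dotBr -mulmxBr.
  apply: le_trans (dot_le_enorm _ _) _.
  apply: le_trans (ler_wpM2l (enorm_ge0 _) (enorm_mulmx_le _ _)) _.
  rewrite (_ : _ * t = enorm w * (LH * (t * enorm v) * enorm v)); last by ring.
  rewrite ler_wpM2l ?enorm_ge0// ler_wpM2r ?enorm_ge0//.
  apply: le_trans (HL _ _) _.
  by rewrite scale0r addr0 addrC addKr enormZ ger0_norm.
have := taylor1_le pdp dpL.
by rewrite /p /dp scale1r scale0r addr0 -!dotBr.
Qed.

(** * The gradient of the smoothed function *)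

Lemma lipschitz_continuous (R : realType) (d : nat) (g : 'rV[R]_d -> R)
    (L : R) :
  (forall x z, `|g x - g z| <= L * enorm (x - z)) -> continuous g.
Proof.
move=> gL x; apply/(cvgrPdist_le (FF := nbhs_filter x)) => eps eps0.
have cx : continuous (fun z : 'rV[R]_d => L * enorm (x + (-1) *: z)).
  apply: (@continuous_cstM _ 'rV[R]_d).
  exact: (continuous_affine (@enorm_continuous R d)).
have := cx x; rewrite /continuous_at scaleN1r subrr.
have -> : enorm (0 : 'rV[R]_d) = 0.
  by rewrite /enorm big1 ?sqrtr0 => [//|k _]; rewrite mxE expr0n.
rewrite mulr0 => /(cvgrPdist_le (FF := nbhs_filter x))/(_ _ eps0).
apply: (@filterS _ _ (nbhs_filter x)) => z.
rewrite sub0r normrN scaleN1r; apply: le_trans.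
exact: le_trans (gL x z) (ler_norm _).
Qed.

Section grad_smooth.
Context {R : realType} {d : nat}.
Variables (f : 'rV[R]_d -> R) (delta : R) (x : 'rV[R]_d) (i : 'I_d).
Hypothesis df : forall z, differentiable f z.
Hypothesis cg : continuous (fun z => grad f z 0 i).
Let e : 'rV[R]_d := delta_mx 0 i.

(** Differentiation under the integral sign. For [h] in [-1, 1] and [u] in the
    ball, the points [x + delta *: u + h *: e] stay in a fixed ball, which is
    compact, so the continuous partial derivative is dominated by a constant. *)
Lemma grad_smooth :
  grad (smooth delta f) x 0 i =
  ball_mean (fun v => grad f (x + delta *: v) 0 i).
Proof.
have cf : continuous f by move=> z; exact: differentiable_continuous.
rewrite mxE -[x in LHS]addr0 -[0 in LHS](scale0r e) -derive1_line.
pose F (h : R) (t : d.-tuple (measurableTypeR R)) :=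
  f (x + h *: e + delta *: rowt t).
rewrite (_ : (fun s => _) =
    fun h => \int[uniform_ball d]_(t in @unit_ball R d) F h t); last first.
  by apply/funext => h; rewrite smoothE.
have d1F h t : partial1of2 F h t = grad f (x + delta *: rowt t + h *: e) 0 i.
  rewrite [RHS]mxE -(derive1_line f (x + delta *: rowt t) e h).
  rewrite /partial1of2.
  rewrite (_ : F^~ t = fun s => f (x + delta *: rowt t + s *: e))//.
  by apply/funext => s; rewrite /F addrAC.
have [C hC] := continuous_bounded_ball (F := fun z => grad f z 0 i)
  (`|x| + `|delta| + 1) cg.
have mB := @measurable_unit_ball R d.
(* The dominating function must be nonnegative everywhere, whence the max. *)
rewrite (@differentiation_under_integral _ _ _ _ _ _ mB 0 (-1) 1 _ _ _
  (cst (Num.max 0 C))).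
- by apply: eq_Rintegral => t _; rewrite d1F scale0r addr0.
- by rewrite /= in_itv/= ltrN10 ltr01.
- by move=> h _; apply: integrable_rowt (continuous_affine _).
- move=> h t _ _; rewrite /F.
  under eq_fun do rewrite addrAC.
  by apply: derivable_line; exact: diff_derivable.
- by move=> t; rewrite /= le_max lexx.
- exact: (integrable_rowt (F := cst (Num.max 0 C))) (@cst_continuous _ _ _).
move=> h t; rewrite /= in_itv/= => h1 tB.
rewrite d1F le_max; apply/orP; right; apply: hC.
have e1 : `|e| <= 1 by apply: enorm_le1_normr; rewrite enorm_delta.
have h1' : `|h| <= 1 by rewrite ler_norml; apply/andP; split; lra.
apply: le_trans (ler_normD _ _) _; apply: lerD.
  apply: le_trans (ler_normD _ _) _; rewrite lerD2l normrZ ler_piMr//.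
  exact: enorm_le1_normr.
by rewrite normrZ mulr_ile1.
Qed.

End grad_smooth.

(** * From local bounds to the averaged gradients *)

Section gap.
Context {R : realType} {d M : nat}.
Variables (f : 'rV[R]_d -> R) (delta : R) (y : 'I_M -> 'rV[R]_d).
Hypothesis M0 : (0 < M)%N.
Hypothesis df : forall z, differentiable f z.
Hypothesis cg : forall i, continuous (fun z => grad f z 0 i).

Let continuous_dot_term (w x : 'rV[R]_d) i :
  continuous (fun v : 'rV[R]_d => w 0 i * grad f (x + delta *: v) 0 i).
Proof. exact/continuous_cstM/(continuous_affine (@cg i)). Qed.

Lemma continuous_dot_grad (w x : 'rV[R]_d) :
  continuous (fun v : 'rV[R]_d => dot w (grad f (x + delta *: v))).
Proof. by apply: continuous_big => [|i _]; first exact: add_continuous. Qed.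

Lemma dot_grad_smooth (w x : 'rV[R]_d) :
  dot w (grad (smooth delta f) x) =
  ball_mean (fun v => dot w (grad f (x + delta *: v))).
Proof.
have cgx i := continuous_affine (x := x) (r := delta) (@cg i).
rewrite /dot ball_mean_sum => [|i]; last exact: continuous_dot_term.
by apply: eq_bigr => i _; rewrite ball_meanZ// -grad_smooth.
Qed.

(** Tested against [w], the difference of the two gradients is a mean over [i]
    and over the ball. The term in [a] has mean zero over the ball by symmetry,
    and the terms in [l w] cancel in the sum over [i], so [B] alone survives. *)
Lemma gap_le (B : R) (l : 'rV[R]_d -> 'rV[R]_d) : 0 <= B ->
  (forall w i, exists a, forall v, enorm v <= 1 ->
     dot w (grad f (average y) - grad f (y i + delta *: v)) <=
     enorm w * B + dot (l w) (y i - average y) + dot a v) ->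
  enorm (grad f (average y)) <=
    enorm (average (fun i => grad (smooth delta f) (y i))) + B.
Proof.
move=> B0 hB; set c := average y; set A := average _.
rewrite -[grad f c](subrK A) addrC.
apply: le_trans (enormD _ _) _; rewrite lerD2l.
apply: enorm_le_dual => // w.
have MR0 : 0 < M%:R :> R by rewrite ltr0n.
have hi i : dot w (grad f c) - dot w (grad (smooth delta f) (y i)) <=
    enorm w * B + dot (l w) (y i - c).
  have cw := continuous_dot_grad (w := w) (x := y i).
  rewrite dot_grad_smooth -{1}(ball_mean_cst (d := d) (dot w (grad f c))).
  rewrite -ball_meanB; [|exact: cst_continuous|exact: cw].
  have [a ha] := hB w i.
  apply: (@ball_mean_le _ _ _ _ a) => [v|v v1]; last by rewrite -dotBr ha.
  apply: (@continuousB _ _ _ (cst (dot w (grad f c)))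
    (fun v : 'rV[R]_d => dot w (grad f (y i + delta *: v)))).
    exact: cst_continuous.
  exact: cw.
have sumy : \sum_i (y i - c) = 0.
  rewrite sumrB sumr_const card_ord /c /average -scaler_nat scalerA.
  by rewrite mulfV ?gt_eqF// scale1r subrr.
have : \sum_i (dot w (grad f c) - dot w (grad (smooth delta f) (y i))) <=
    \sum_(i < M) (enorm w * B + dot (l w) (y i - c)).
  by apply: ler_sum => i _; exact: hi.
rewrite sumrB big_split /= -(dot_sumr (l w)) sumy dot0r addr0.
rewrite !sumr_const card_ord.
rewrite -[X in X - _ <= _]mulr_natl -[leRHS]mulr_natl -(dot_sumr w) => h.
rewrite dotBr /A /average dotZr -(ler_pM2l MR0) mulrBr mulrA mulfV ?gt_eqF//.
by rewrite mul1r.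
Qed.

End gap.

Theorem proposition4p1 (R : realType) (d : nat) (hd : (0 < d)%N)
  (f : 'rV[R]_d -> R) (delta : R) (hdelta : 0 < delta)
  (M : nat) (hM : (0 < M)%N) (y : 'I_M -> 'rV[R]_d)
  (hy : forall i : 'I_M, enorm (y i - average y) <= delta) :
  (forall Lg : R,
    (forall x : 'rV[R]_d, differentiable f x) ->
    (forall x z : 'rV[R]_d,
      enorm (grad f x - grad f z) <= Lg * enorm (x - z)) ->
    enorm (grad f (average y)) <=
      enorm (average (fun i : 'I_M => grad (smooth delta f) (y i)))
      + 2 * Lg * delta)
  /\
  (forall LH : R,
    twice_differentiable f ->
    (forall x z : 'rV[R]_d,
      opnorm (hessian f x - hessian f z) <= LH * enorm (x - z)) ->
    enorm (grad f (average y)) <=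
      enorm (average (fun i : 'I_M => grad (smooth delta f) (y i)))
      + LH * delta ^+ 2).
Proof.
pose i0 := Ordinal hd; pose e : 'rV[R]_d := delta_mx 0 i0.
(* Points at distance 1 exist, which forces both constants to be nonnegative. *)
have e1 : enorm (e - 0) = 1 by rewrite subr0; exact: enorm_delta.
set c := average y.
split=> [Lg df gL|LH [df dg] HL].
  have Lg0 : 0 <= Lg.
    by rewrite -[Lg]mulr1 -e1; apply: le_trans (gL e 0); exact: enorm_ge0.
  have cg i : continuous (fun z => grad f z 0 i).
    apply: (lipschitz_continuous (L := Lg)) => x z; apply: le_trans (gL x z).
    by apply: le_trans (normr_coord_le_enorm _ i); rewrite !mxE.
  apply: (gap_le (l := fun=> 0) hM df cg) => // [|w i].
    by rewrite mulr_ge0 ?mulr_ge0// ltW.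
  exists 0 => v v1; rewrite !(dotC 0) !dot0r !addr0.
  apply: le_trans (dot_le_enorm _ _) _; rewrite ler_wpM2l ?enorm_ge0//.
  apply: le_trans (gL _ _) _; rewrite -mulrA mulrCA ler_wpM2l//.
  rewrite opprD addrA -[c - _]opprB -opprD enormN mulr_natl mulr2n.
  apply: le_trans (enormD _ _) _; rewrite lerD ?hy//.
  by rewrite enormZ (gtr0_norm hdelta) ler_piMr// ltW.
have LH0 : 0 <= LH.
  rewrite -[LH]mulr1 -e1; apply: le_trans (HL e 0).
  have := enorm_mulmx_le (hessian f e - hessian f 0) (e - 0).
  by rewrite e1 mulr1; apply: le_trans; exact: enorm_ge0.
have cg i : continuous (fun z => grad f z 0 i).
  move=> x.
  apply: (@continuous_comp _ _ _ (grad f) (fun A : 'rV[R]_d => A 0 i));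
    last exact: coord_continuous.
  exact: differentiable_continuous.
pose H := hessian f c.
apply: (gap_le (l := fun w => - (w *m H^T)) hM df cg) => // [|w i].
  by rewrite mulr_ge0// sqr_ge0.
(* An opaque s keeps the linearity rewrites below from expanding it. *)
have [s sE] : exists s, s = y i - c by exists (y i - c).
rewrite -sE.
(* The coefficient of v in the expansion: the first part comes from the squared
   length of s + delta *: v, the second one from the Hessian term. *)
exists ((LH * enorm w * delta) *: s - delta *: (w *m H^T)) => v v1.
have sqE : enorm (s + delta *: v) ^+ 2 =
    enorm s ^+ 2 + 2 * delta * dot s v + delta ^+ 2 * enorm v ^+ 2.
  by rewrite sqr_enormD dotZr enormZ exprMn real_normK ?num_real// !mulrA.
have quad : LH * enorm w * (enorm s ^+ 2 + delta ^+ 2 * enorm v ^+ 2) <=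
    LH * enorm w * (2 * delta ^+ 2).
  rewrite ler_wpM2l ?mulr_ge0 ?enorm_ge0// mulr_natl mulr2n lerD//.
    by rewrite lerXn2r ?nnegrE ?enorm_ge0 ?(ltW hdelta)// sE; exact: hy.
  by rewrite ler_piMr ?sqr_ge0// exprn_ile1 ?enorm_ge0.
(* The expansion bounds grad f (y i + delta *: v) - grad f c, so the opposite
   test vector is needed. *)
have := grad_taylor c (s + delta *: v) (- w) dg HL.
rewrite (_ : c + (s + delta *: v) = y i + delta *: v); last first.
  by rewrite addrA sE addrCA subrr addr0.
rewrite enormN sqE dotNl -/H mulmxDl -scalemxAl.
rewrite !dotBr !dotDr !dotZr !dotDl !dotNl !dotZl -!dot_mulmx => taylor.
lra.
Qed.
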